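(* The classes $\mathrm{DIM}^0$ and $\mathrm{DIM}^1_{\mathrm{str}}$ are not $\boldsymbol\Sigma^0_2$-classes.
   Context: $\mathbf{C}=\{0,1\}^{\mathbb N}$; $A\upharpoonright n$ is the first $n$ bits of $A$; $K$ is prefix-free Kolmogorov complexity. The constructive dimension and strong dimension of $A\in\mathbf C$ are $\dim(A)=\liminf_n K(A\upharpoonright n)/n$ and ${\mathrm{Dim}}(A)=\limsup_n K(A\upharpoonright n)/n$ (these are the known Kolmogorov characterizations of the gale-based definitions: $\dim(A)$, resp. ${\mathrm{Dim}}(A)$, is the infimum of $s$ such that some lower semicomputable $s$-gale, i.e. $d:\{0,1\}^*\to[0,\infty)$ with $2^sd(w)=d(w0)+d(w1)$, has $\limsup$, resp. $\liminf$, of $d(A\upharpoonright n)$ equal to $\infty$). $\mathrm{DIM}^0=\{A:\dim(A)=0\}$, $\mathrm{DIM}^1_{\mathrm{str}}=\{A:{\mathrm{Dim}}(A)=1\}$. $\boldsymbol\Sigma^0_2$ is the class of countable unions of closed subsets of $\mathbf C$. *)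

(* Defs.v *)
From Stdlib Require List.
From HB Require Import structures.
From mathcomp Require Import all_boot all_order all_algebra.
From mathcomp Require Import all_classical all_reals all_analysis.
Set Implicit Arguments.
Unset Strict Implicit.
Unset Printing Implicit Defensive.
Import Order.TTheory GRing.Theory Num.Theory.
Local Open Scope classical_set_scope.
Local Open Scope ring_scope.

(* Partial recursive functions on tuples of naturals (the latter given as
   sequences).  There is no arity bookkeeping: a missing argument is read as 0
   and extra arguments are ignored, so every program still denotes one partial
   recursive function of each arity. *)
Inductive recprog : Type :=
| RZero
| RSucc
| RProj of nat
| RComp of recprog & seq recprog
| RPrec of recprog & recprog
| RMu of recprog.

(* The graph of [c]: halting on input [xs] with output [y]. *)
Fixpoint receval (c : recprog) : seq nat -> nat -> Prop :=
  match c with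
  | RZero => fun _ y => y = 0%N
  | RSucc => fun xs y => y = (nth 0%N xs 0).+1
  | RProj i => fun xs y => y = nth 0%N xs i
  | RComp f gs => fun xs y =>
      exists2 zs : seq nat,
        List.Forall2 (fun (g : seq nat -> nat -> Prop) z => g xs z)
          (map receval gs) zs
        & receval f zs y
  (* f(0, xs) = base(xs) and f(i + 1, xs) = step(i, f(i, xs), xs); the sequence
     [s] lists f(0, xs), ..., f(n, xs), where n is the first argument *)
  | RPrec base step => fun xs y =>
      let n := nth 0%N xs 0 in let xs' := behead xs in
      exists s : nat -> nat,
        [/\ receval base xs' (s 0%N),
            forall i, (i < n)%N -> receval step (i :: s i :: xs') (s i.+1)
          & y = s n]
  (* least y with f(y, xs) = 0, all the previous values being defined *)
  | RMu f => fun xs y =>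
      receval f (y :: xs) 0%N /\
      forall z, (z < y)%N -> exists v : nat, receval f (z :: xs) v.+1
  end.

(* The bijection from binary strings to naturals given by bijective base-2
   numeration, least significant digit first. *)
Fixpoint strcode (w : seq bool) : nat :=
  if w is b :: w' then ((strcode w').*2 + b).+1 else 0%N.

(* A machine is a partial function on binary strings; [None] means that it
   diverges. *)
Definition partial_computable (M : seq bool -> option (seq bool)) : Prop :=
  exists c : recprog, forall (p : seq bool) (y : nat),
    receval c [:: strcode p] y <-> omap strcode (M p) = Some y.

Definition prefix_free_machine (M : seq bool -> option (seq bool)) : Prop :=
  partial_computable M /\
  forall p q : seq bool,
    M p <> None -> M q <> None -> prefix p q -> p = q.

(* The reference machines in the definition of K: prefix-free machines that are
   optimal, i.e. give descriptions that are at most a constant longer than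
   those of any given prefix-free machine. *)
Definition optimal_prefix_free_machine (U : seq bool -> option (seq bool)) :
    Prop :=
  prefix_free_machine U /\
  forall M, prefix_free_machine M ->
    exists k : nat, forall p x, M p = Some x ->
      exists2 q, U q = Some x & (size q <= size p + k)%N.

Section dimension.
Context {R : realType}.
Variable U : seq bool -> option (seq bool).

(* K(x) = min {|p| : U(p) = x}, with value +oo if x is not an output of U (which
   does not happen when U is optimal). *)
Definition prefixK (x : seq bool) : \bar R :=
  ereal_inf [set (size p)%:R%:E | p in [set p | U p = Some x]].

(* the first n bits of A *)
Definition restr (A : cantor_space) (n : nat) : seq bool := mkseq A n.

Definition Kratio (A : cantor_space) (n : nat) : \bar R :=
  (prefixK (restr A n) * (n%:R^-1)%:E)%E.

Definition cdim (A : cantor_space) : \bar R := limn_einf (Kratio A).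

Definition cDim (A : cantor_space) : \bar R := limn_esup (Kratio A).

End dimension.

Definition DIM0 (R : realType) (U : seq bool -> option (seq bool)) :
    set cantor_space :=
  [set A | cdim (R := R) U A = 0%E].

Definition DIM1str (R : realType) (U : seq bool -> option (seq bool)) :
    set cantor_space :=
  [set A | cDim (R := R) U A = 1%E].

(* Main.v *)
From Stdlib Require List.
Require Import Defs.
From HB Require Import structures.
From mathcomp Require Import all_boot all_order all_algebra.
From mathcomp Require Import all_classical all_reals all_analysis borel_hierarchy.
From mathcomp Require Import zify.
Set Implicit Arguments.
Unset Strict Implicit.
Unset Printing Implicit Defensive.
Import Order.TTheory GRing.Theory Num.Theory.

(* Both classes are comeager.  Every string w extends to the highly compressible
   strings w 0^m, so a generic sequence has dimension 0; every string also
   extends to incompressible strings, so a generic sequence has strong dimension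
   1.  Both complements are dense: a cylinder [w] contains w 0^oo, which is not
   in DIM^1_str, and, by Kraft's inequality, a sequence A with
   K(A|n) >= n - |w| for all n, which is not in DIM^0.  If such a class were a
   countable union of closed sets, none of these would contain a cylinder, and
   a Baire category construction would give a generic sequence outside all of
   them.

   Upper bounds on K come from the prefix code 0^n 1 0^j 1 of m = n^2 + j, whose
   length is O(sqrt m) for j <= 2n. *)

(** * Computability and prefix-free machines *)

Section prefix_free_machines.
Local Open Scope nat_scope.

(* Programs ignore arity, so a total function is only specified on the
   argument sequences of one given length. *)
Definition computable (k : nat) (F : seq nat -> nat) : Prop :=
  exists c, forall xs, size xs = k -> forall y, receval c xs y <-> y = F xs.

Lemma eq_computable k F G :
  (forall xs, size xs = k -> F xs = G xs) -> computable k F -> computable k G.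
Proof. by move=> FG [c cF]; exists c => xs sxs y; rewrite -FG //; exact: cF. Qed.

Lemma computable_nth k i : computable k (fun xs => nth 0 xs i).
Proof. by exists (RProj i). Qed.

Lemma computable_comp k m F (Gs : seq (seq nat -> nat)) :
  size Gs = m -> computable m F -> List.Forall (computable k) Gs ->
  computable k (fun xs => F [seq G xs | G <- Gs]).
Proof.
move=> sGs cF cGs.
have [cs csE] : exists cs, forall xs, size xs = k -> forall zs,
    List.Forall2 (fun (g : seq nat -> nat -> Prop) z => g xs z)
      (map receval cs) zs <-> zs = [seq G xs | G <- Gs].
  elim: cGs {sGs} => [|G {}Gs [g gG] _ [cs csE]].
    exists [::] => xs _ zs; split => [H|->]; first by inversion H.
    exact: List.Forall2_nil.
  exists (g :: cs) => xs sxs zs; split => [|->].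
    case: zs => [|z zs]; first by move=> H; inversion H.
    move=> /List.Forall2_cons_iff[/(proj1 (gG xs sxs _)) ->].
    by move=> /(proj1 (csE xs sxs _)) ->.
  by apply: List.Forall2_cons; [exact/gG|exact/csE].
have [c cE] := cF.
exists (RComp c cs) => xs sxs y; split.
  case=> zs /(proj1 (csE xs sxs zs)) -> /(proj1 (cE _ _ _)); apply.
  by rewrite size_map.
move=> ->; exists [seq G xs | G <- Gs]; first exact/csE.
by apply/cE; rewrite ?size_map.
Qed.

Lemma computable_comp1 k h g : computable 1 (fun xs => h (nth 0 xs 0)) ->
  computable k g -> computable k (fun xs => h (g xs)).
Proof.
move=> ch cg; apply: (@computable_comp k 1 (fun xs => h (nth 0 xs 0)) [:: g]) => //.
by do !constructor.
Qed.

Lemma computable_comp2 k h f g :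
  computable 2 (fun xs => h (nth 0 xs 0) (nth 0 xs 1)) ->
  computable k f -> computable k g -> computable k (fun xs => h (f xs) (g xs)).
Proof.
move=> ch cf cg.
apply: (@computable_comp k 2 (fun xs => h (nth 0 xs 0) (nth 0 xs 1)) [:: f; g]) => //.
by do !constructor.
Qed.

Lemma computable_reindex k (s : seq nat) F : computable (size s) F ->
  computable k (fun xs => F [seq nth 0 xs i | i <- s]).
Proof.
move=> cF.
apply: (@eq_computable k
  (fun xs => F [seq G xs | G <- [seq (fun xs => nth 0 xs i) | i <- s]])).
  by move=> xs _; rewrite -map_comp.
apply: computable_comp cF _; first by rewrite size_map.
by elim: s => [|i s IHs] /=; constructor => //; exact: computable_nth.
Qed.

Lemma map_nth_iota (xs : seq nat) m k : size xs = m + k ->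
  [seq nth 0 xs i | i <- iota m k] = drop m xs.
Proof.
move=> sxs; apply: (@eq_from_nth _ 0).
  by rewrite size_map size_iota size_drop sxs addKn.
move=> i; rewrite size_map size_iota => ik.
by rewrite (nth_map 0) ?size_iota// nth_iota// nth_drop.
Qed.

Lemma computable_drop k m F :
  computable k F -> computable (m + k) (fun xs => F (drop m xs)).
Proof.
move=> cF; apply: (@eq_computable _ (fun xs => F [seq nth 0 xs i | i <- iota m k])).
  by move=> xs sxs; rewrite map_nth_iota.
by apply: computable_reindex; rewrite size_iota.
Qed.

Lemma computable_iteri k n b S :
  computable k n -> computable k b -> computable k.+2 S ->
  computable k (fun xs => iteri (n xs) (fun i r => S (i :: r :: xs)) (b xs)).
Proof.
move=> cn [cb bE] [cS SE].
(* [RPrec] recurses on the head of its arguments, so F takes the bound as an extra head; [Gs] then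
   substitutes [n xs] for it. *)
pose F xs := iteri (nth 0 xs 0) (fun i r => S (i :: r :: behead xs)) (b (behead xs)).
have cF : computable k.+1 F.
  exists (RPrec cb cS) => -[//|m xs] [sxs] y; rewrite /F /=; split.
    case=> s [/(proj1 (bE _ sxs _)) s0 sS ->].
    suff sE i : i <= m -> s i = iteri i (fun i r => S (i :: r :: xs)) (b xs).
      exact: sE.
    elim: i => [//|i IHi] im /=.
    rewrite -IHi ?(ltnW im)//; apply/(proj1 (SE _ _ _) (sS i im)).
    by rewrite /= sxs.
  move=> ->; exists (fun j => iteri j (fun i r => S (i :: r :: xs)) (b xs)).
  split=> //; first exact/bE.
  by move=> i _; apply/SE => //=; rewrite sxs.
pose Gs := n :: [seq (fun xs => nth 0 xs i) | i <- iota 0 k].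
apply: (@eq_computable k (fun xs => F [seq G xs | G <- Gs])).
  move=> xs sxs; rewrite /F/Gs /= -map_comp.
  by rewrite (_ : [seq _ | i <- iota 0 k] = xs)// (@map_nth_iota xs 0 k)// drop0.
apply: computable_comp cF _; first by rewrite /Gs/= size_map size_iota.
constructor => //.
by elim: (iota 0 k) => [|i s IHs] /=; constructor => //; exact: computable_nth.
Qed.

(** * Arithmetic closure of the total computable functions *)

Lemma computable_succ k f : computable k f -> computable k (fun xs => (f xs).+1).
Proof. by move=> cf; apply: (@computable_comp1 k succn f _ cf); exists RSucc. Qed.

Lemma computable_const k n : computable k (fun=> n).
Proof.
elim: n => [|n IHn]; first by exists RZero.
exact: (computable_succ IHn).
Qed.

Lemma computable_add k f g :
  computable k f -> computable k g -> computable k (fun xs => f xs + g xs).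
Proof.
move=> cf cg; apply: (@eq_computable _
    (fun xs => iteri (f xs) (fun i r => (nth 0 (i :: r :: xs) 1).+1) (g xs))).
  by move=> xs _; elim: (f xs) => //= n ->.
exact: (computable_iteri cf cg (computable_succ (computable_nth _ _))).
Qed.

Lemma computable_mul k f g :
  computable k f -> computable k g -> computable k (fun xs => f xs * g xs).
Proof.
move=> cf cg; apply: (@eq_computable _ (fun xs => iteri (f xs)
    (fun i r => g (drop 2 (i :: r :: xs)) + nth 0 (i :: r :: xs) 1) 0)).
  by move=> xs _; elim: (f xs) => //= n ->; rewrite drop0 mulSn.
apply: (computable_iteri cf (computable_const _ _)
  (computable_add (computable_drop 2 cg) (computable_nth _ 1))).
Qed.

Lemma computable_pred k f : computable k f -> computable k (fun xs => (f xs).-1).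
Proof.
move=> cf; apply: (@eq_computable _
    (fun xs => iteri (f xs) (fun i r => nth 0 (i :: r :: xs) 0) 0)).
  by move=> xs _; case: (f xs).
exact: (computable_iteri cf (computable_const _ _) (computable_nth _ _)).
Qed.

Lemma computable_sub k f g :
  computable k f -> computable k g -> computable k (fun xs => f xs - g xs).
Proof.
move=> cf cg; apply: (@eq_computable _
    (fun xs => iteri (g xs) (fun i r => (nth 0 (i :: r :: xs) 1).-1) (f xs))).
  by move=> xs _; elim: (g xs) => [|n /= ->]; rewrite ?subn0 ?subnS.
exact: (computable_iteri cg cf (computable_pred (computable_nth _ _))).
Qed.

Lemma computable_exp2 k f : computable k f -> computable k (fun xs => 2 ^ f xs).
Proof.
move=> cf; apply: (@eq_computable _
    (fun xs => iteri (f xs) (fun i r => 2 * nth 0 (i :: r :: xs) 1) 1)).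
  by move=> xs _; elim: (f xs) => //= n ->; rewrite expnS.
exact: (computable_iteri cf (computable_const _ _)
  (computable_mul (computable_const _ 2) (computable_nth _ 1))).
Qed.

(** A product vanishes iff some factor does, so this provides bounded existential search. *)
Lemma computable_prod k n F : computable k n -> computable k.+1 F ->
  computable k (fun xs => \prod_(i < n xs) F ((i : nat) :: xs)).
Proof.
move=> cn cF; apply: (@eq_computable _ (fun xs => iteri (n xs)
    (fun i r => (nth 0 (i :: r :: xs) 1) *
      F [seq nth 0 (i :: r :: xs) j | j <- 0 :: iota 2 k]) 1)).
  move=> xs sxs; elim: (n xs) => [|m IHm]; first by rewrite big_ord0.
  rewrite big_ord_recr/= -IHm; congr (_ * F (_ :: _)).
  by rewrite map_nth_iota/= ?drop0 ?sxs.
have cF' : computable k.+2 (fun ys => F [seq nth 0 ys j | j <- 0 :: iota 2 k]).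
  by apply: computable_reindex; rewrite /= size_iota.
exact: (computable_iteri cn (computable_const _ _)
  (computable_mul (computable_nth _ 1) cF')).
Qed.

(** The output is found by unbounded search. It is unique, so T is nonzero at every smaller
    candidate, as [RMu] demands. *)
Lemma partial_computable_graph (M : seq bool -> option (seq bool)) T :
  computable 2 T ->
  (forall y p, T [:: y; strcode p] = 0 <-> omap strcode (M p) = Some y) ->
  partial_computable M.
Proof.
move=> [c cT] TM; exists (RMu c) => p y; rewrite -TM; split => /=.
  by case=> /(proj1 (cT [:: y; strcode p] erefl _)) <-.
move=> Ty; split; first exact/cT.
move=> z zy; exists (T [:: z; strcode p]).-1; apply/cT => //.
rewrite prednK// lt0n; apply/eqP => /TM Tz; move/TM: Ty; rewrite Tz => -[zy'].
by rewrite zy' ltnn in zy.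
Qed.

Lemma prod_cons_eq0 n (F : seq nat -> nat) xs :
  \prod_(i < n) F ((i : nat) :: xs) = 0 <-> exists2 i, i < n & F (i :: xs) = 0.
Proof.
split=> [/eqP|[i ni Fi]]; last by rewrite (bigD1 (Ordinal ni))//= Fi.
by rewrite prod_nat_seq_eq0 => /hasP[i _ /eqP Fi]; exists (i : nat).
Qed.

(** * Arithmetic of string codes *)

Lemma strcode_inj : injective strcode.
Proof.
elim=> [|b u IHu] [|b' v] //= [] E.
have -> : b = b' by move: E; case: b; case: b' => /=; lia.
by congr (_ :: _); apply: IHu; lia.
Qed.

Lemma strcode_surj y : exists w, strcode w = y.
Proof.
elim/ltn_ind: y => -[|y] IHy; first by exists [::].
have [|w wE] := IHy y./2; first by lia.
by exists (odd y :: w); rewrite /= wE; lia.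
Qed.

(** [(strcode w).+1] has the binary digits w, least significant first, topped by a leading 1.
    Concatenation shifts the number of v and fills in the digits of u, whose leading 1 is cancelled
    by the term on the left. *)
Lemma strcode_cat u v : (strcode (u ++ v)).+1 + 2 ^ size u =
  2 ^ size u * (strcode v).+1 + (strcode u).+1.
Proof. by elim: u => [|b u IHu] /=; rewrite ?expnS ?mul1n; lia. Qed.

Lemma strcode_nseq0 n : (strcode (nseq n false)).+1 = 2 ^ n.
Proof. by elim: n => // n IHn; rewrite /= expnS; lia. Qed.

Lemma leq_exp2_strcode u : 2 ^ size u <= (strcode u).+1 < 2 ^ (size u).+1.
Proof. by elim: u => // b u IHu; rewrite /= !expnS in IHu *; case: b; lia. Qed.

Lemma size_strcode u l : size u = l <-> 2 ^ l <= (strcode u).+1 < 2 ^ l.+1.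
Proof.
split=> [<-|/andP[lu ul]]; first exact: leq_exp2_strcode.
have /andP[lu' ul'] := leq_exp2_strcode u.
have := leq_ltn_trans lu ul'; have := leq_ltn_trans lu' ul.
by rewrite !ltn_exp2l// !ltnS => *; apply/eqP; rewrite eqn_leq; apply/andP.
Qed.

Definition delim (n j : nat) : seq bool :=
  nseq n false ++ true :: nseq j false ++ [:: true].

Lemma size_delim n j : size (delim n j) = n + j + 2.
Proof. by rewrite size_cat/= size_cat !size_nseq/=; lia. Qed.

Lemma nseq_false_true_inj n n' (s s' : seq bool) :
  nseq n false ++ true :: s = nseq n' false ++ true :: s' -> n = n' /\ s = s'.
Proof.
elim: n n' => [|n IHn] [|n'] //= => [[->]//|[/IHn[-> ->]]//].
Qed.

Lemma delim_cat_inj n j u n' j' u' : delim n j ++ u = delim n' j' ++ u' ->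
  [/\ n = n', j = j' & u = u'].
Proof.
rewrite /delim -!catA /= -!catA /= => /nseq_false_true_inj[->].
by move=> /nseq_false_true_inj[-> ->].
Qed.

(** Prepending 0 doubles [(strcode w).+1]; prepending 1 doubles it and adds 1. Parsing an input thus
    becomes a numerical equation. *)
Lemma strcode_delim_cat n j u : (strcode (delim n j ++ u)).+1 =
  2 ^ n * (2 * (2 ^ j * (2 * (strcode u).+1 + 1)) + 1).
Proof.
have strcode0 k s : (strcode (nseq k false ++ s)).+1 = 2 ^ k * (strcode s).+1.
  have := strcode_cat (nseq k false) s; rewrite strcode_nseq0 size_nseq; lia.
rewrite /delim -!catA /= -!catA /= strcode0 /=; congr (_ * _).
have := strcode0 j (true :: u); rewrite /=; set a := strcode _; set b := strcode _.
set c := 2 ^ j; nia.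
Qed.

(* The machine 0^n 1 0^j 1 u |-> G m u, where m = n^2 + j and |u| = l m; as m
   determines |u|, its domain is prefix-free. *)
Section delimited_machine.
Variables (l : nat -> nat) (g : nat -> nat -> nat) (G : nat -> seq bool -> seq bool).
Hypothesis cl : computable 1 (fun xs => l (nth 0 xs 0)).
Hypothesis cg : computable 2 (fun xs => g (nth 0 xs 0) (nth 0 xs 1)).
Hypothesis gG : forall m u, strcode (G m u) = g m (strcode u).

Let graph p x := exists n j u,
  [/\ p = delim n j ++ u, size u = l (n * n + j) & x = G (n * n + j) u].

(** The output is picked by classical choice; unique decoding makes it the only one, and
    computability comes from the graph. *)
Let machine p := if pselect (exists x, graph p x) is left h
  then Some (projT1 (cid h)) else None.

Let machineE p x : machine p = Some x <-> graph p x.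
Proof.
rewrite /machine; case: pselect => [h|nh]; last first.
  by split=> // px; case: nh; exists x.
have ux y z : graph p y -> graph p z -> y = z.
  move=> [n [j [u [-> _ ->]]]] [n' [j' [u' [E _ ->]]]].
  by have [-> -> ->] := delim_cat_inj E.
by case: cid => y /= py; split => [[<-]//|/(ux _ _ py) ->].
Qed.

(* The argument sequence is [v; j; n; y; x]; the value is 0 iff x codes
   0^n 1 0^j 1 u where strcode u = v, |u| = l (n^2 + j) and y = g (n^2 + j) v. *)
Let test (xs : seq nat) : nat :=
  let v := nth 0 xs 0 in let j := nth 0 xs 1 in let n := nth 0 xs 2 in
  let y := nth 0 xs 3 in let x := nth 0 xs 4 in
  let m := n * n + j in
  let e := 2 ^ n * (2 * (2 ^ j * (2 * v.+1 + 1)) + 1) in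
  (x.+1 - e) + (e - x.+1) + (2 ^ l m - v.+1) + (v.+2 - 2 ^ (l m).+1)
  + (y - g m v) + (g m v - y).

Let computable_test : computable 5 test.
Proof.
have cn i : computable 5 (fun xs => nth 0 xs i) by exact: computable_nth.
have cm := computable_add (computable_mul (cn 2) (cn 2)) (cn 1).
have clm := computable_comp1 cl cm.
have cgm := computable_comp2 cg cm (cn 0).
by do ![apply: computable_add | apply: computable_sub | apply: computable_succ
  | apply: computable_exp2 | apply: computable_mul | exact: computable_const
  | exact: cn | exact: clm | exact: cgm].
Qed.

(** Each product prepends one variable, so positions 3, 2 and 1 all hold the code of the input,
    which bounds all three searches. *)
Let search_v xs := \prod_(v < (nth 0 xs 3).+1) test ((v : nat) :: xs).
Let search_j xs := \prod_(j < (nth 0 xs 2).+1) search_v ((j : nat) :: xs).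
Let search xs := \prod_(n < (nth 0 xs 1).+1) search_j ((n : nat) :: xs).

Let computable_search : computable 2 search.
Proof.
have cn k i : computable k (fun xs => (nth 0 xs i).+1).
  exact: (computable_succ (computable_nth _ _)).
by do 3 apply: computable_prod (cn _ _) _; exact: computable_test.
Qed.

Let searchE y p :
  search [:: y; strcode p] = 0 <-> omap strcode (machine p) = Some y.
Proof.
have -> : omap strcode (machine p) = Some y <-> exists2 x, graph p x & strcode x = y.
  split; last by move=> [x /machineE -> <-].
  by case E: (machine p) => [x|//] [<-]; exists x => //; exact/machineE.
split=> [/prod_cons_eq0[n _ /prod_cons_eq0[j _ /prod_cons_eq0[v _]]]|].
  (* A sum of truncated differences is 0 only if each is; in pairs they give the parsing of p, the
     length of u (via [size_strcode]) and the value of y. *)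
  have [u <-] := strcode_surj v; rewrite /test /= -strcode_delim_cat => E.
  exists (G (n * n + j) u); last by rewrite gG; lia.
  exists n, j, u; split => //; last by apply/size_strcode; lia.
  by apply: strcode_inj; lia.
move=> [x [n [j [u [-> su ->]]]] <-]; rewrite gG.
set X := strcode (delim n j ++ u).
have XE : X.+1 = _ := strcode_delim_cat n j u.
have {}su := (proj1 (size_strcode _ _) su).
have n2 := ltn_expl n (isT : 1 < 2); have j2 := ltn_expl j (isT : 1 < 2).
apply/prod_cons_eq0; exists n; first by rewrite XE; nia.
apply/prod_cons_eq0; exists j; first by rewrite XE; nia.
apply/prod_cons_eq0; exists (strcode u); first by rewrite XE; nia.
by rewrite /test /= -strcode_delim_cat; lia.
Qed.

Lemma delimited_machine : exists2 M, prefix_free_machine M &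
  forall n j u, size u = l (n * n + j) ->
    M (delim n j ++ u) = Some (G (n * n + j) u).
Proof.
exists machine; last by move=> n j u su; apply/machineE; exists n, j, u.
split; first exact: partial_computable_graph computable_search searchE.
move=> p q.
case pE : (machine p) => [x|//] _; case qE : (machine q) => [y|//] _.
move: pE qE => /machineE[n [j [u [-> su _]]]] /machineE[n' [j' [u' [-> su' _]]]].
move=> /prefixP[r]; rewrite -[RHS]catA => /delim_cat_inj[nE jE uE].
move: su'; rewrite uE nE jE size_cat su -[RHS]addn0 => /addnI/size0nil ->.
by rewrite cats0.
Qed.

Lemma optimal_delimited U : optimal_prefix_free_machine U ->
  exists C, forall m u, size u = l m -> exists p n,
    [/\ U p = Some (G m u), n * n <= m & size p <= l m + 3 * n + C].
Proof.
move=> [_ Uopt]; have [M pfM ME] := delimited_machine.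
have [k kP] := Uopt M pfM.
(* With n the integer square root of m, j = m - n^2 <= 2n, so the code of m has n + j + 2 <= 3n + 2
   bits; k is the cost of passing from M to U. *)
exists (k + 2) => m u su.
have [n nm mn] : exists2 n, n * n <= m & m < n.+1 * n.+1.
  elim: m {su} => [|m [n nm mn]]; first by exists 0.
  have [mn'|mn'] := ltnP m.+1 (n.+1 * n.+1); first by exists n => //; lia.
  by exists n.+1 => //; nia.
have mE : m = n * n + (m - n * n) by lia.
have MG : M (delim n (m - n * n) ++ u) = Some (G m u) by rewrite ME -mE.
have [q Uq sq] := kP _ _ MG; exists q, n; split=> //.
by apply: (leq_trans sq); rewrite size_cat size_delim su; nia.
Qed.
End delimited_machine.

(** Writing x literally after the code of its length gives K(x) <= |x| + O(sqrt |x|). *)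
Lemma optimal_id U : optimal_prefix_free_machine U ->
  exists C, forall x, exists p n,
    [/\ U p = Some x, n * n <= size x & size p <= size x + 3 * n + C].
Proof.
move=> hU.
have [C CP] := @optimal_delimited id (fun _ v => v) (fun _ u => u)
  (computable_nth _ _) (computable_nth _ _) (fun _ _ => erefl) U hU.
by exists C => x; exact: CP.
Qed.

(** With w built into the machine, the code of m alone describes w 0^m. *)
Lemma optimal_zeros U w : optimal_prefix_free_machine U ->
  exists C, forall m, exists p n,
    [/\ U p = Some (w ++ nseq m false), n * n <= m & size p <= 3 * n + C].
Proof.
move=> hU.
pose g (m v : nat) := 2 ^ size w * 2 ^ m + strcode w - 2 ^ size w.
have cg : computable 2 (fun xs => g (nth 0 xs 0) (nth 0 xs 1)).
  apply: computable_sub (computable_const _ _).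
  apply: computable_add (computable_const _ _).
  apply: (computable_mul (computable_const _ _)).
  exact: (computable_exp2 (computable_nth _ _)).
have gG m u : strcode (w ++ nseq m false) = g m (strcode u).
  by rewrite /g -(strcode_nseq0 m); have := strcode_cat w (nseq m false); lia.
have [C CP] := @optimal_delimited (fun=> 0) g (fun m _ => w ++ nseq m false)
  (computable_const _ 0) cg gG U hU.
by exists C => m; exact: (CP m [::]).
Qed.

End prefix_free_machines.

(** * The Cantor space *)

Section cantor_category.
Local Open Scope classical_set_scope.
Local Open Scope nat_scope.

Lemma eq_restr (A B : cantor_space) n :
  (forall i, i < n -> A i = B i) -> restr A n = restr B n.
Proof.
move=> AB; apply: (@eq_from_nth _ false); rewrite !size_mkseq// => i ni.
by rewrite !nth_mkseq// AB.
Qed.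

Lemma restr_eq (A B : cantor_space) n i :
  restr A n = restr B n -> i < n -> A i = B i.
Proof. by move=> AB ni; rewrite -(nth_mkseq false A ni) -/(restr A n) AB nth_mkseq. Qed.

(** Otherwise F has, for every n, a point agreeing with A on n bits; these points converge to A, and
    F is closed. *)
Lemma notin_closed_restr (F : set cantor_space) A : closed F -> ~ F A ->
  exists n, forall B, restr B n = restr A n -> ~ F B.
Proof.
move=> cF nFA; apply/not_existsP => H; apply: nFA.
have {}H n : exists B, restr B n = restr A n /\ F B.
  move/existsNP: (H n) => [B /not_implyP[AB /contrapT FB]]; by exists B.
have [g gP] := choice H.
have gA : g @ \oo --> A.
  (* In the product topology it is enough to treat one coordinate N at a time, and it is constant
     from index N + 1 on. *)
  apply/cvg_sup => N U [V] [[W] oW <-] WfN WU.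
  apply: (filterS WU); rewrite nbhs_simpl; exists N.+1 => // i /= Ni.
  by rewrite /= (restr_eq (gP i).1 Ni).
by apply: (closed_cvg _ cF _ _ gA); apply: nearW => n; case: (gP n).
Qed.

Lemma limit_of_prefixes (x : nat -> seq bool) :
  (forall n, prefix (x n) (x n.+1)) -> (forall n, n <= size (x n)) ->
  exists A : cantor_space, forall n, restr A (size (x n)) = x n.
Proof.
(* Bit i is read from [x i.+1], which has more than i bits. *)
move=> xS sx; exists (fun i => nth false (x i.+1) i) => n.
have xm m k : prefix (x m) (x (m + k)).
  elim: k => [|k IHk]; first by rewrite addn0 prefix_refl.
  by rewrite addnS (prefix_trans IHk).
have nthx m k i : m <= k -> i < size (x m) -> nth false (x k) i = nth false (x m) i.
  by move=> /subnKC <- im; have /prefixP[z ->] := xm m (k - m); rewrite nth_cat im.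
apply: (@eq_from_nth _ false); rewrite size_mkseq// => i im; rewrite nth_mkseq//.
have [ni|ni] := leqP n i.+1; first by rewrite (nthx n).
by rewrite (nthx i.+1 n) ?(ltnW ni).
Qed.

Lemma prefix_restr (A : cantor_space) m n : m <= n -> prefix (restr A m) (restr A n).
Proof.
move=> mn; apply/prefixP; exists (drop m (restr A n)).
rewrite -{1}(cat_take_drop m (restr A n)); congr (_ ++ _).
by rewrite /restr /mkseq -map_take take_iota (minn_idPl mn).
Qed.

(** Density of the complement keeps every F k from containing a cylinder. Leaving F k and then
    meeting P k, for k = 0, 1, ..., builds a point of D outside every F k. *)
Lemma not_Fsigma_of_generic (D : set cantor_space) (P : nat -> seq bool -> Prop) :
  (forall k w, exists u, P k (w ++ u)) ->
  (forall A, (forall k, exists n, P k (restr A n)) -> D A) ->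
  (forall w, exists2 A, restr A (size w) = w & ~ D A) ->
  ~ Fsigma D.
Proof.
move=> Pdense PD Dco [F cF DF].
have step : forall kw : nat * seq bool, exists w' : seq bool,
    [/\ prefix kw.2 w', size kw.2 < size w', P kw.1 w' &
      forall A, restr A (size w') = w' -> ~ F kw.1 A].
  move=> [k w] /=.
  have [A Aw nDA] := Dco w.
  have nFA : ~ F k A by move=> FA; apply: nDA; rewrite DF; exists k.
  have [n nF] := notin_closed_restr (cF k) nFA.
  (* Length n secures avoidance of F k; exceeding [size w] makes the prefixes grow to an infinite
     sequence. *)
  pose m := maxn n (size w).+1.
  have [u Pu] := Pdense k (restr A m).
  exists (restr A m ++ u); split => //.
  - rewrite -{1}Aw; apply: prefix_trans (prefix_prefix _ _).
    by apply: prefix_restr; rewrite /m; lia.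
  - by rewrite size_cat size_mkseq /m; lia.
  - move=> B Bm; apply: nF; apply: eq_restr => i ni.
    have im : i < m by rewrite /m; lia.
    rewrite -(nth_mkseq false A im) -/(restr A m).
    have sim : i < size (restr A m) by rewrite size_mkseq.
    have <- : nth false (restr A m ++ u) i = nth false (restr A m) i.
      by rewrite nth_cat sim.
    by rewrite -Bm nth_mkseq// size_cat; lia.
have [f fP] := choice step.
pose x := fix x n := if n is n'.+1 then f (n', x n') else [::].
have [||A Ax] := @limit_of_prefixes x.
- by move=> n; have [] := fP (n, x n).
- elim=> [//|n IHn]; have [_ /= sx _ _] := fP (n, x n).
  exact: leq_ltn_trans IHn sx.
have DA : D A.
  by apply: PD => k; exists (size (x k.+1)); rewrite Ax; have [] := fP (k, x k).
move: DA; rewrite DF => -[k _]; have [_ _ _] := fP (k, x k); apply.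
exact: (Ax k.+1).
Qed.

End cantor_category.

(** * Kraft's inequality and incompressible sequences *)

Section kraft.
Local Open Scope ring_scope.

(** The uniform measure of the cylinder [x]. *)
Definition dyadic (x : seq bool) : rat := 2^-1 ^+ size x.

Lemma dyadic_cat x y : dyadic (x ++ y) = dyadic x * dyadic y.
Proof. by rewrite /dyadic size_cat exprD. Qed.

Lemma dyadic_gt0 x : 0 < dyadic x.
Proof. by rewrite exprn_gt0. Qed.

Lemma dyadic_rcons x b : dyadic (rcons x b) = dyadic x / 2.
Proof. by rewrite /dyadic size_rcons exprSr. Qed.

Lemma prefix_rcons_neq (x y : seq bool) :
  prefix x y -> x != y -> prefix (rcons x true) y = ~~ prefix (rcons x false) y.
Proof.
move=> /prefixP[[|b z] ->]; first by rewrite cats0 eqxx.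
move=> _; rewrite -!cats1 !prefix_catr //=.
by case: b; rewrite /= eqxx ?prefix0s.
Qed.

(** Kraft's inequality inside [x], by induction on how far the words may exceed x in length: either
    x is in s, hence alone there, or s splits by the bit following x. *)
Lemma kraft_below (x : seq bool) (s : seq (seq bool)) :
  uniq s -> {in s &, forall p q, prefix p q -> p = q} ->
  {in s, forall p, prefix x p} -> \sum_(p <- s) dyadic p <= dyadic x.
Proof.
have [m] : exists m, (\max_(p <- s) size p <= size x + m)%N.
  by exists (\max_(p <- s) size p)%N; rewrite leq_addl.
elim: m x s => [|m IHm] x s sm us pfs xs.
  have {}xs p : p \in s -> p = x.
    move=> ps; have /prefixP[z zE] := xs _ ps.
    have : (size p <= size x + 0)%N by apply: leq_trans sm; exact: leq_bigmax_seq.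
    rewrite zE size_cat addn0 -[leqRHS]addn0 leq_add2l leqn0 size_eq0.
    by move=> /eqP->; rewrite cats0.
  case: s us xs {pfs sm} => [|p [|q s]] us xs.
  - by rewrite big_nil ltW ?dyadic_gt0.
  - by rewrite big_seq1 (xs p) ?mem_head.
  - have pE : p = x by apply: xs; rewrite mem_head.
    have qE : q = x by apply: xs; rewrite !inE eqxx orbT.
    by move: us; rewrite pE qE /= mem_head.
have [xins|xnins] := boolP (x \in s).
  rewrite (bigD1_seq x)//= big1_seq ?addr0// => p /andP[px ps].
  by rewrite (pfs x p) ?eqxx ?xs in px.
have nx p : p \in s -> x != p by apply: contraTneq => <-.
rewrite (bigID (prefix (rcons x false))) /= [leRHS]splitr.
rewrite -{1}(dyadic_rcons x false) -(dyadic_rcons x true).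
rewrite -[X in X + _ <= _]big_filter -[X in _ + X <= _]big_filter.
have half b (t := [seq p <- s | prefix (rcons x b) p]) :
    \sum_(p <- t) dyadic p <= dyadic (rcons x b).
  apply: IHm; rewrite ?filter_uniq//.
  - rewrite big_filter big_mkcond; apply/bigmax_leqP_seq => p ps _.
    case: ifP => // _; apply: leq_trans (leq_bigmax_seq _ ps isT) _.
    by rewrite size_rcons addSnnS.
  - by move=> p q; rewrite !mem_filter => /andP[_ ps] /andP[_ qs]; exact: pfs.
  - by move=> p; rewrite mem_filter => /andP[].
apply: lerD; first exact: half.
rewrite (_ : [seq _ <- s | _] = [seq p <- s | prefix (rcons x true) p]) ?half//.
by apply: eq_in_filter => p ps; rewrite prefix_rcons_neq ?xs ?nx.
Qed.

(* The bits of A are chosen greedily, keeping the total weight of the bad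
   extensions of each prefix x below 2^-|x|. *)
Lemma exists_avoiding (B : seq bool -> Prop) (w : seq bool) :
  (forall s, uniq s -> {in s, forall y, B y /\ prefix w y} ->
    \sum_(y <- s) dyadic y < dyadic w) ->
  exists2 A, restr A (size w) = w &
    forall n, (size w <= n)%N -> ~ B (restr A n).
Proof.
pose light x := forall s, uniq s -> {in s, forall y, B y /\ prefix x y} ->
    \sum_(y <- s) dyadic y < dyadic x.
rewrite -/(light w) => lw.
have step x : exists b, light x -> light (rcons x b).
  apply: contrapT => /forallNP nl.
  have /not_implyP[lx nl0] := nl false; have /not_implyP[_ nl1] := nl true.
  move: nl0 => /existsNP[s /not_implyP[us /not_implyP[sB /negP]]].
  move: nl1 => /existsNP[t /not_implyP[ut /not_implyP[tB /negP]]].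
  rewrite -!leNgt => ht hs.
  (* If both children of x were heavy, their witnesses s and t, lying in disjoint cylinders, would
     together make x heavy. *)
  have := lx (s ++ t); rewrite big_cat/=.
  have le1 : dyadic x <= \sum_(i <- s) dyadic i + \sum_(i <- t) dyadic i.
    by apply: le_trans (lerD hs ht); rewrite !dyadic_rcons -splitr.
  move=> /(_ _ _)/(le_lt_trans le1); rewrite ltxx.
  have pre b y : prefix (rcons x b) y -> prefix x y.
    exact: prefix_trans (prefix_rcons _ _).
  move=> H; suff: false by []; apply: H.
    rewrite cat_uniq us ut andbT /=; apply/hasPn => y /tB[_ ty]; apply/negP => /sB[_ sy].
    have xy : x != y.
      apply: contraTneq ty => <-; apply/negP => /prefixP[z /(congr1 size)].
      by rewrite size_cat size_rcons; lia.
    by have := prefix_rcons_neq (pre _ _ ty) xy; rewrite ty sy.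
  by move=> y; rewrite mem_cat => /orP[/sB|/tB] [? /pre].
have [f fP] := choice step.
pose x := fix x n := if n is n'.+1 then rcons (x n') (f (x n')) else w.
have sx n : size (x n) = (size w + n)%N.
  by elim: n => [|n IHn] /=; rewrite ?addn0// size_rcons IHn addnS.
have lx n : light (x n) by elim: n => //= n; exact: fP.
have [||A Ax] := @limit_of_prefixes x.
- by move=> n /=; exact: prefix_rcons.
- by move=> n; rewrite sx leq_addl.
exists A; first exact: (Ax 0%N).
move=> n /subnKC <-; rewrite -sx Ax; set y := x _ => By.
(* A bad prefix y of A would alone carry the full weight 2^-|y|. *)
suff : dyadic y < dyadic y by rewrite ltxx.
have := lx (n - size w)%N [:: y] isT; rewrite big_seq1; apply.
by move=> z; rewrite inE => /eqP ->; rewrite prefix_refl.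
Qed.

(** If p describes y and |p| + |w| < |y|, then 2^-|y| <= 2^-(|w|+1) 2^-|p|. By Kraft's inequality
    for the programs, such y weigh at most 2^-(|w|+1) < 2^-|w| in total, so they can be avoided
    above w. *)
Lemma exists_incompressible (U : seq bool -> option (seq bool)) (w : seq bool) :
  (forall p q, U p <> None -> U q <> None -> prefix p q -> p = q) ->
  exists2 A, restr A (size w) = w &
    forall n p, U p = Some (restr A n) -> (n <= size p + size w)%N.
Proof.
move=> pfU.
pose B y := exists2 p, U p = Some y & (size p + size w < size y)%N.
have [s us sB|A Aw AB] := @exists_avoiding B w.
  (* One short program is chosen per bad string; the choice is injective on bad strings because U is
     a function. *)
  have [f fP] : exists f : seq bool -> seq bool, forall y, B y ->
      U (f y) = Some y /\ (size (f y) + size w < size y)%N.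
    suff /choice[f fP] : forall y, exists p, B y ->
      U p = Some y /\ (size p + size w < size y)%N by exists f.
    move=> y.
    have [[p Up py]|nB] := pselect (B y); last by exists [::].
    by exists p.
  have {}sB y : y \in s -> U (f y) = Some y /\ (size (f y) + size w < size y)%N.
    by move=> /sB[/fP].
  have kr : \sum_(p <- map f s) dyadic p <= 1.
    apply: (@kraft_below [::]) => //.
    - rewrite map_inj_in_uniq// => y z /sB[Uy _] /sB[Uz _] fyz.
      by move: Uy; rewrite fyz Uz => -[].
    - move=> _ _ /mapP[y /sB[Uy _] ->] /mapP[z /sB[Uz _] ->].
      by apply: pfU; rewrite ?Uy ?Uz.
    - by move=> p _; rewrite prefix0s.
  apply: (@le_lt_trans _ _ (dyadic w / 2 * \sum_(p <- map f s) dyadic p)).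
    rewrite big_map mulr_sumr big_seq [leRHS]big_seq; apply: ler_sum => y /sB[_ fy].
    rewrite -(dyadic_rcons w true) -dyadic_cat /dyadic ler_wiXn2l//.
    by rewrite size_cat size_rcons addnC addnS.
  apply: (@le_lt_trans _ _ (dyadic w / 2)).
    by rewrite ler_piMr// divr_ge0 ?ltW ?dyadic_gt0.
  by rewrite ltr_pdivrMr// ltr_pMr ?dyadic_gt0.
exists A => // n p Up; have [nw|wn] := ltnP n (size w); first by lia.
rewrite leqNgt; apply/negP => pn; apply: (AB n wn).
by exists p; rewrite ?size_mkseq.
Qed.

End kraft.

(** * Dimensions *)

Local Open Scope classical_set_scope.
Local Open Scope ring_scope.

(** * Bounds on upper and lower limits *)

Section limits.
Context {R : realType}.
Implicit Types (u : (\bar R)^nat) (c : \bar R).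
Local Open Scope ereal_scope.

Lemma limn_esup_le u c N :
  (forall n, (N <= n)%N -> u n <= c) -> limn_esup u <= c.
Proof.
move=> uc; rewrite limn_esup_lim (cvg_lim _ (@cvg_esups_inf _ u))//.
apply: (@le_trans _ _ (esups u N)); first by apply: ereal_inf_lbound; exists N.
by apply: ge_ereal_sup => _ [n /= Nn <-]; exact: uc.
Qed.

Lemma limn_esup_ge u c :
  (forall N, exists2 n, (N <= n)%N & c <= u n) -> c <= limn_esup u.
Proof.
move=> uc; rewrite limn_esup_lim (cvg_lim _ (@cvg_esups_inf _ u))//.
apply: le_ereal_inf_tmp => _ [N _ <-]; have [n Nn cu] := uc N.
by apply: (le_trans cu); apply: ereal_sup_ubound; exists n.
Qed.

Lemma limn_einf_ge u c N :
  (forall n, (N <= n)%N -> c <= u n) -> c <= limn_einf u.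
Proof.
move=> uc; rewrite -[c]oppeK leeN2.
by apply: (@limn_esup_le _ _ N) => n /uc; rewrite leeN2.
Qed.

Lemma limn_einf_le u c :
  (forall N, exists2 n, (N <= n)%N & u n <= c) -> limn_einf u <= c.
Proof.
move=> uc; rewrite -[c]oppeK leeN2; apply: limn_esup_ge => N.
by have [n Nn un] := uc N; exists n; rewrite ?leeN2.
Qed.

End limits.

Section Kratio.
Context {R : realType} (U : seq bool -> option (seq bool)).

Lemma Kratio_ge0 A n : (0 <= Kratio (R := R) U A n)%E.
Proof.
apply: mule_ge0; last by rewrite lee_fin invr_ge0.
by apply: le_ereal_inf_tmp => _ [p _ <-]; rewrite lee_fin.
Qed.

Lemma Kratio_le A n p a b : U p = Some (restr A n) -> (0 < n)%N -> (0 < b)%N ->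
  (size p * b <= a * n)%N -> (Kratio (R := R) U A n <= (a%:R / b%:R)%:E)%E.
Proof.
move=> Up n0 b0 pab; rewrite /Kratio lee_pdivrMr ?ltr0n//.
apply: (@le_trans _ _ (size p)%:R%:E); first by apply: ereal_inf_lbound; exists p.
rewrite lee_fin mulrAC ler_pdivlMr ?ltr0n// -!natrM ler_nat.
exact: pab.
Qed.

Lemma Kratio_ge A n a b : (0 < n)%N -> (0 < b)%N ->
  (forall p, U p = Some (restr A n) -> (a * n <= size p * b)%N) ->
  ((a%:R / b%:R)%:E <= Kratio (R := R) U A n)%E.
Proof.
move=> n0 b0 pab; rewrite /Kratio lee_pdivlMr ?ltr0n//.
apply: le_ereal_inf_tmp => _ [p /= Up <-].
rewrite -EFinM lee_fin mulrAC ler_pdivrMr ?ltr0n// -!natrM ler_nat.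
exact: pab.
Qed.

End Kratio.

(** Let t = a(3 + C). If n <= t, the chosen N is bound enough; if n > t, then a(3n + C) <= t n <=
    n^2 <= m. *)
Lemma sqrt_small a C : exists N, forall m n : nat,
  (N <= m)%N -> (n * n <= m)%N -> (a * (3 * n + C) <= m)%N.
Proof.
exists (a * (3 * (a * (3 + C)) + C))%N => m n Nm nm.
have [n_small|n_big] := leqP n (a * (3 + C)).
  by apply: leq_trans Nm; rewrite leq_mul2l leq_add2r leq_mul2l n_small !orbT.
apply: leq_trans nm; apply: (@leq_trans (a * (3 + C) * n)); last first.
  by rewrite leq_mul2r (ltnW n_big) orbT.
rewrite -mulnA leq_mul2l mulnDl leq_add2l leq_pmulr ?orbT//.
exact: leq_ltn_trans n_big.
Qed.

(** * Dense complements and generic points of the two classes *)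

Section dimension.
Context {R : realType} (U : seq bool -> option (seq bool)).
Hypothesis hU : optimal_prefix_free_machine U.

Lemma exists_cdim_gt0 w : exists2 A, restr A (size w) = w & ~ DIM0 R U A.
Proof.
have [A Aw KA] := exists_incompressible w hU.1.2.
exists A => //; rewrite /DIM0 /= => A0.
suff : ((1%:R / 2%:R)%:E <= cdim (R := R) U A)%E.
  by rewrite A0 lee_fin leNgt divr_gt0.
(* Beyond 2|w|, K(A|n) >= n - |w| >= n/2. *)
apply: (@limn_einf_ge _ _ _ (2 * size w).+1) => n wn.
by apply: Kratio_ge => // [|p /KA]; lia.
Qed.

Lemma exists_cDim_lt1 w : exists2 A, restr A (size w) = w & ~ DIM1str R U A.
Proof.
(* The default [false] of [nth] makes A the sequence w 0^oo. *)
pose A : cantor_space := nth false w.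
have Aw m : restr A (size w + m) = w ++ nseq m false.
  apply: (@eq_from_nth _ false); rewrite size_mkseq ?size_cat ?size_nseq// => i im.
  rewrite nth_mkseq// nth_cat /A; case: ltnP => // wi.
  by rewrite nth_default// nth_nseq if_same.
exists A; first by rewrite -[X in restr A X]addn0 Aw cats0.
rewrite /DIM1str /= => A1.
suff : (cDim (R := R) U A <= (1%:R / 2%:R)%:E)%E.
  by rewrite A1 lee_fin leNgt ltr_pdivrMr// mul1r ltr1n.
have [C CP] := optimal_zeros w hU; have [N NP] := sqrt_small 2 C.
apply: (@limn_esup_le _ _ _ (size w + N).+1) => n wn.
have [p [s [Up sm ps]]] := CP (n - size w)%N.
apply: (@Kratio_le _ _ _ _ p) => //; rewrite ?(leq_ltn_trans _ wn)//.
  by rewrite Up -Aw subnKC//; lia.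
by have := NP (n - size w)%N s; lia.
Qed.

Lemma not_Fsigma_DIM0 : ~ Fsigma (DIM0 R U).
Proof.
(* P k says K(x) <= |x|/(k+1); the clause k < |x| forces this to recur at arbitrarily long prefixes,
   as a lower limit requires. *)
apply: (@not_Fsigma_of_generic _ (fun k x => (k < size x)%N /\
    exists2 p, U p = Some x & (size p * k.+1 <= size x)%N)).
- move=> k w; have [C CP] := optimal_zeros w hU.
  have [N NP] := sqrt_small k.+1 C; pose m := (N + k.+1)%N.
  have [p [s [Up sm ps]]] := CP m.
  exists (nseq m false); rewrite size_cat size_nseq; split; first by rewrite /m; lia.
  exists p => //; apply: leq_trans (leq_addl _ _).
  apply: leq_trans (NP m s (leq_addr _ _) sm).
  by rewrite mulnC leq_mul2l ps orbT.
- move=> A PA; apply/eqP; rewrite eq_le; apply/andP; split; last first.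
    by apply: (@limn_einf_ge _ _ _ 0) => n _; exact: Kratio_ge0.
  suff cA k : (cdim (R := R) U A <= (1%:R / k.+1%:R)%:E)%E.
    apply/lee_addgt0Pr => e e0; rewrite add0e.
    have [k] := ltr_add_invr e0; rewrite add0r => /ltW ke.
    by apply: (le_trans (cA k)); rewrite lee_fin mul1r.
  apply: limn_einf_le => N; have [n] := PA (maxn k N).
  rewrite size_mkseq => -[kn [p Up pn]]; exists n; first by lia.
  apply: (Kratio_le Up) => //; first by lia.
  by rewrite mul1n; apply: leq_trans pn; rewrite leq_mul2l; lia.
- exact: exists_cdim_gt0.
Qed.

(** By [optimal_id], K(A|n)/n is at most 1 + O(n^(-1/2)), hence eventually at most (k+2)/(k+1) for
    each k. *)
Lemma cDim_le1 A : (cDim (R := R) U A <= 1)%E.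
Proof.
have [C CP] := optimal_id hU.
suff cA k : (cDim (R := R) U A <= (k.+2%:R / k.+1%:R)%:E)%E.
  apply/lee_addgt0Pr => e e0.
  have [k] := ltr_add_invr e0; rewrite add0r => /ltW ke.
  apply: (le_trans (cA k)); rewrite -EFinD lee_fin.
  by rewrite -(natr1 k.+1) mulrDl divff ?pnatr_eq0// mul1r lerD2l.
have [N NP] := sqrt_small k.+1 C.
apply: (@limn_esup_le _ _ _ N.+1) => n Nn.
have [p [s]] := CP (restr A n); rewrite size_mkseq => -[Up sn ps].
apply: (Kratio_le Up) => //; first exact: leq_ltn_trans Nn.
by have := NP n s (ltnW Nn) sn; nia.
Qed.

Lemma not_Fsigma_DIM1str : ~ Fsigma (DIM1str R U).
Proof.
apply: (@not_Fsigma_of_generic _ (fun k x => (k < size x)%N /\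
    forall p, U p = Some x -> (k * size x <= size p * k.+1)%N)).
- move=> k w; have [A Aw KA] := exists_incompressible w hU.1.2.
  (* As n >= |w|(k+1), n - |w| >= n k/(k+1); the extra k + 1 makes n exceed k. *)
  pose n := (size w * k.+1 + k.+1)%N.
  have wn : (size w <= n)%N by rewrite /n; nia.
  have /prefixP[u uE] := prefix_restr A wn.
  exists u; rewrite -{1 2 3}Aw -uE size_mkseq; split; first by rewrite /n; lia.
  by move=> p /KA np; rewrite /n in np *; nia.
- move=> A PA; apply/eqP; rewrite eq_le cDim_le1 /=.
  suff cA k : ((k%:R / k.+1%:R)%:E <= cDim (R := R) U A)%E.
    apply/lee_subgt0Pr => e e0.
    have [k] := ltr_add_invr e0; rewrite add0r => /ltW ke.
    apply: le_trans (cA k); rewrite -EFinB lee_fin.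
    rewrite lerBlDr (le_trans _ (lerD (lexx _) ke))//.
    by rewrite -{2}[_^-1]mul1r -mulrDl natr1 divff ?pnatr_eq0.
  apply: limn_esup_ge => N; have [n] := PA (maxn k N).
  rewrite size_mkseq => -[kn Kn]; exists n; first by lia.
  apply: Kratio_ge => // [|p /Kn np]; first by lia.
  (* For |p| < n, the bound for M = max(k, N) reads M (n - |p|) <= |p|, which passes down from M to
     k. *)
  have [|pn] := leqP n (size p); first by nia.
  have : (k * (n - size p) <= maxn k N * (n - size p))%N.
    by rewrite leq_mul2r leq_maxl orbT.
  by rewrite !mulnBr; nia.
- exact: exists_cDim_lt1.
Qed.

End dimension.

Theorem mainTheorem6 (R : realType) (U : seq bool -> option (seq bool))
    (hU : optimal_prefix_free_machine U) :
  ~ Fsigma (DIM0 R U) /\ ~ Fsigma (DIM1str R U).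
Proof. by split; [exact: not_Fsigma_DIM0|exact: not_Fsigma_DIM1str]. Qed.
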